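(* Let $K$ be a number field with ring of integers $\mathcal{O}_K$, and let its ideal class group $\operatorname{Cl}(K)$ have order $h$. Let $\mathfrak p_1,\ldots,\mathfrak p_m$ be nonzero prime ideals of $\mathcal{O}_K$ (not necessarily distinct) with $m\ge h$, and suppose their ideal classes occupy $t$ distinct classes of $\operatorname{Cl}(K)$, i.e. $|\{[\mathfrak p_1],\ldots,[\mathfrak p_m]\}|=t$. Then there is a nonempty index set $I\subseteq\{1,\ldots,m\}$ such that \[ |I|\le h-t+1 \] and \[ \prod_{i\in I}\mathfrak p_i=(\pi) \] for some irreducible element $\pi\in\mathcal{O}_K$.
   Context: $[\mathfrak p]$ denotes the class of the ideal $\mathfrak p$ in the ideal class group $\operatorname{Cl}(K)$ of $\mathcal{O}_K$. Repeated prime ideals among $\mathfrak p_1,\ldots,\mathfrak p_m$ are counted as distinct indexed occurrences. *)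

(* Defs.v *)
From mathcomp Require Import all_boot all_order all_algebra all_field.
From mathcomp Require Import all_classical.

Set Implicit Arguments.
Unset Strict Implicit.
Unset Printing Implicit Defensive.

Import GRing.Theory.
Local Open Scope classical_set_scope.
Local Open Scope ring_scope.

(* A number field is a finite extension of rat.  The ring of integers, its
   ideals and the fractional ideals are all subsets of the field, so that one
   product of ideals serves for integral and fractional ideals alike. *)

Definition ringOfIntegers (K : fieldExtType rat) : set K :=
  [set x | integralOver (intr : int -> K) x].
Arguments ringOfIntegers : clear implicits.

Section IdealsOfIntegers.
Variable K : fieldExtType rat.
Local Notation OK := (ringOfIntegers K).
Implicit Types (M I J P : set K) (x : K).

Definition integerSubmodule M : Prop :=
  [/\ M 0, forall a b, M a -> M b -> M (a + b)
     & forall a b, OK a -> M b -> M (a * b)].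

Definition integralIdeal I : Prop := integerSubmodule I /\ I `<=` OK.

Definition primeIdeal P : Prop :=
  [/\ integralIdeal P, ~ P 1
     & forall a b, OK a -> OK b -> P (a * b) -> P a \/ P b].

Definition fractionalIdeal I : Prop :=
  [/\ integerSubmodule I, I != [set 0]
     & exists d, [/\ OK d, d != 0 & forall a, I a -> OK (d * a)]].

Definition idealMul I J : set K :=
  [set z | exists n (a b : 'I_n -> K),
     [/\ forall i, I (a i), forall i, J (b i) & z = \sum_i a i * b i]].

Definition principalIdeal x : set K := [set a * x | a in OK].

(* For x outside OK this is a genuinely fractional ideal. *)
Definition principalFractionalIdeals : set (set K) :=
  [set principalIdeal x | x in [set x | x != 0]].

(* The coset of I modulo the subgroup of principal fractional ideals, for the
   group law idealMul on fractional ideals. *)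
Definition idealClass I : set (set K) :=
  [set idealMul I J | J in principalFractionalIdeals].

Definition unitInteger x : Prop := OK x /\ exists2 y, OK y & x * y = 1.

Definition irreducibleInteger x : Prop :=
  [/\ OK x, x != 0, ~ unitInteger x
     & forall a b, OK a -> OK b -> x = a * b ->
         unitInteger a \/ unitInteger b].

End IdealsOfIntegers.

(* The underlying set of the quotient of the group of fractional ideals by the
   subgroup of principal ones. *)
Definition classGroup (K : fieldExtType rat) : set (set (set K)) :=
  [set idealClass I | I in @fractionalIdeal K].
Arguments classGroup : clear implicits.

(* OK, the unit ideal, is the value of the empty product. *)
Definition idealProd (K : fieldExtType rat) (m : nat) (p : 'I_m -> set K)
    (I : {set 'I_m}) : set K :=
  \big[@idealMul K/ringOfIntegers K]_(i in I) p i.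

(* Main.v *)
Require Import Defs.
From HB Require Import structures.
From mathcomp Require Import all_boot all_order all_algebra all_field.
From mathcomp Require Import all_classical.
From mathcomp Require Import ring.
Set Implicit Arguments.
Unset Strict Implicit.
Unset Printing Implicit Defensive.

Import GRing.Theory.
Local Open Scope classical_set_scope.
Local Open Scope ring_scope.

(* Write g_1, ..., g_t for primes in distinct classes and r_1, ..., r_(h-t) for
   further primes among the given ones.  The t classes [g_i]^-1 are distinct, so
   among these and the h-t+1 classes [r_1 ... r_k] two coincide, which gives a
   nonempty subproduct of at most h-t+1 primes that is principal.  The generator
   of a principal subproduct of minimal length is irreducible, because by unique
   factorization a proper factor would generate a shorter one.
   The ideal theory needed comes from the finiteness of the class group by
   Hurwitz's argument, itself resting on the finiteness of OK / d OK. *)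

(** * Products of OK-submodules of K, principal ideals and ideal classes *)

Section IdealArithmetic.
Variable K : fieldExtType rat.
Local Notation OK := (ringOfIntegers K).
Implicit Types (M I J L P : set K) (x y z : K).

Lemma integer_int (n : int) : OK n%:~R.
Proof. exact: integral_id. Qed.

Lemma integer0 : OK 0. Proof. exact: integral0. Qed.
Lemma integer1 : OK 1. Proof. exact: integral1. Qed.

Lemma integerD x y : OK x -> OK y -> OK (x + y).
Proof. exact: integral_add. Qed.

Lemma integerM x y : OK x -> OK y -> OK (x * y).
Proof. exact: integral_mul. Qed.

Lemma integerB x y : OK x -> OK y -> OK (x - y).
Proof. exact: integral_sub. Qed.

Lemma integer_sum (T : finType) (F : T -> K) :
  (forall i, OK (F i)) -> OK (\sum_i F i).
Proof.
by move=> OF; elim/big_ind: _ => //; [exact: integer0|exact: integerD].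
Qed.

Lemma submodule_integer : integerSubmodule OK.
Proof. by split; [exact: integer0|exact: integerD|exact: integerM]. Qed.

Lemma submodule_neq0P M : M 0 ->
  reflect (exists2 x, M x & x != 0) (M != [set 0]).
Proof.
move=> M0; apply: (iffP idP) => [/eqP MN0|[x Mx x0]]; last first.
  by apply: contra x0 => /eqP ME; move: Mx; rewrite ME => ->.
apply: contrapT => nex; apply: MN0; apply/seteqP; split=> [x Mx|_ -> //] /=.
by apply: contrapT => /eqP x0; apply: nex; exists x.
Qed.

Lemma idealMul_mem I J x y : I x -> J y -> idealMul I J (x * y).
Proof.
by move=> Ix Jy; exists 1, (fun=> x), (fun=> y); rewrite big_ord1.
Qed.

Lemma idealMul0 I J : idealMul I J 0.
Proof.
by exists 0, (fun=> 0), (fun=> 0); split=> [[]//|[]//|]; rewrite big_ord0.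
Qed.

Lemma idealMulD I J x y :
  idealMul I J x -> idealMul I J y -> idealMul I J (x + y).
Proof.
case=> n [a [b [Ia Jb ->]]] [n' [a' [b' [Ia' Jb' ->]]]].
pose cat (u : 'I_n -> K) (v : 'I_n' -> K) (k : 'I_(n + n')) :=
  match fintype.split k with inl i => u i | inr i => v i end.
exists (n + n')%N, (cat a a'), (cat b b'); split.
- by move=> k; rewrite /cat; case: fintype.split.
- by move=> k; rewrite /cat; case: fintype.split.
rewrite big_split_ord /=; congr (_ + _); apply: eq_bigr => i _; rewrite /cat.
  by rewrite -[lshift _ _]/(unsplit (inl i)) unsplitK.
by rewrite -[rshift _ _]/(unsplit (inr i)) unsplitK.
Qed.

(** Serves as the induction principle for membership in a product: later inclusions are checked on
    single products x * y only. *)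
Lemma idealMul_sub I J M :
    M 0 -> (forall x y, M x -> M y -> M (x + y)) ->
    (forall x y, I x -> J y -> M (x * y)) ->
  idealMul I J `<=` M.
Proof.
move=> M0 MD MM _ [n [a [b [Ia Jb ->]]]].
by elim/big_ind: _ => // i _; apply: MM.
Qed.

Lemma idealMulC : commutative (@idealMul K).
Proof.
suff sub I J : idealMul I J `<=` idealMul J I.
  by move=> I J; apply/seteqP; split; exact: sub.
apply: idealMul_sub; [exact: idealMul0|exact: idealMulD|].
by move=> x y Ix Jy; rewrite mulrC; exact: idealMul_mem.
Qed.

Lemma idealMulA : associative (@idealMul K).
Proof.
have sub I J L : idealMul (idealMul I J) L `<=` idealMul I (idealMul J L).
  apply: idealMul_sub; [exact: idealMul0|exact: idealMulD|].
  move=> x y IJx Ly; move: x IJx; apply: idealMul_sub.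
  - by rewrite mul0r; exact: idealMul0.
  - by move=> u v ? ?; rewrite mulrDl; exact: idealMulD.
  by move=> u v Iu Jv; rewrite -mulrA; do 2 apply: idealMul_mem => //.
move=> I J L; apply/seteqP; split; last exact: sub.
(* The reverse inclusion is [sub] applied with the three factors in reverse order. *)
rewrite idealMulC [idealMul J L]idealMulC [idealMul _ L]idealMulC.
by rewrite [idealMul I J]idealMulC; exact: sub.
Qed.

(** [OK] is neutral only on submodules, so on arbitrary subsets [idealMul] is a commutative
    semigroup law and not a monoid law; this suffices to permute finite products. *)
HB.instance Definition _ :=
  SemiGroup.isComLaw.Build (set K) (@idealMul K) idealMulA idealMulC.

Lemma idealMulCA : left_commutative (@idealMul K).
Proof. by move=> I J L; rewrite !idealMulA [idealMul I J]idealMulC. Qed.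

Lemma submoduleM I J : integerSubmodule I -> integerSubmodule (idealMul I J).
Proof.
case=> _ _ IM; split; [exact: idealMul0|exact: idealMulD|].
move=> a x Oa; move: x; apply: idealMul_sub.
- by rewrite mulr0; exact: idealMul0.
- by move=> u v ? ?; rewrite mulrDr; exact: idealMulD.
by move=> u v Iu Jv; rewrite mulrA; apply: idealMul_mem => //; exact: IM.
Qed.

Lemma idealMul_subl I J :
  integerSubmodule I -> J `<=` OK -> idealMul I J `<=` I.
Proof.
case=> I0 ID IM JO; apply: idealMul_sub => // x y Ix Jy.
by rewrite mulrC; apply: IM => //; exact: JO.
Qed.

Lemma idealMul1 M : integerSubmodule M -> idealMul M OK = M.
Proof.
move=> Mm; apply/seteqP; split; first exact: idealMul_subl.
by move=> x Mx; rewrite -[x]mulr1; apply: idealMul_mem => //; exact: integer1.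
Qed.

Lemma idealMulS I J J' : J `<=` J' -> idealMul I J `<=` idealMul I J'.
Proof.
move=> JJ'; apply: idealMul_sub; [exact: idealMul0|exact: idealMulD|].
by move=> x y Ix /JJ' Jy; exact: idealMul_mem.
Qed.

Lemma mul_principal x M :
  integerSubmodule M -> idealMul (principalIdeal x) M = [set x * y | y in M].
Proof.
case=> M0 MD MM; apply/seteqP; split=> [|_ [y My <-]]; last first.
  apply: idealMul_mem => //; exists 1; [exact: integer1|exact: mul1r].
apply: idealMul_sub; first by exists 0; rewrite ?mulr0.
  move=> _ _ [u Mu <-] [v Mv <-]; exists (u + v); first exact: MD.
  by rewrite mulrDr.
move=> _ y [a Oa <-] My; exists (a * y); first exact: MM.
by rewrite mulrCA mulrA.
Qed.

Lemma principalE x : principalIdeal x = [set x * y | y in OK].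
Proof. by apply/seteqP; split=> _ [a Oa <-]; exists a; rewrite // mulrC. Qed.

Lemma submodule_principal x : integerSubmodule (principalIdeal x).
Proof.
rewrite principalE -mul_principal; last exact: submodule_integer.
rewrite idealMulC; exact/submoduleM/submodule_integer.
Qed.

Lemma principal_integral x : OK x -> principalIdeal x `<=` OK.
Proof. by move=> Ox _ [a Oa <-]; exact: integerM. Qed.

Lemma principal_mem x : principalIdeal x x.
Proof. by exists 1; [exact: integer1|rewrite mul1r]. Qed.

Lemma principal1 : principalIdeal (1 : K) = OK.
Proof.
by apply/seteqP; split=> [_ [a Oa <-]|a Oa]; [|exists a]; rewrite ?mulr1.
Qed.

Lemma principalM x y :
  idealMul (principalIdeal x) (principalIdeal y) = principalIdeal (x * y).
Proof.
rewrite mul_principal; last exact: submodule_principal.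
apply/seteqP; split=> [_ [_ [a Oa <-] <-]|_ [a Oa <-]].
  by exists a; rewrite // mulrCA.
by exists (a * y); [exists a|rewrite mulrCA].
Qed.

Lemma principal_cancel x I J : x != 0 ->
  integerSubmodule I -> integerSubmodule J ->
  idealMul (principalIdeal x) I = idealMul (principalIdeal x) J -> I = J.
Proof.
move=> x0 Im Jm /(congr1 (idealMul (principalIdeal x^-1))).
rewrite !idealMulA principalM mulVf// principal1 ![idealMul OK _]idealMulC.
by rewrite !idealMul1.
Qed.

Definition nonzeroIdeal I := integralIdeal I /\ I != [set 0].

Lemma nonzeroIdeal_exists I : nonzeroIdeal I -> exists2 x, I x & x != 0.
Proof. by case=> [[[I0 _ _] _] /(submodule_neq0P I0)]. Qed.

Lemma nonzeroIdealM I J :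
  nonzeroIdeal I -> nonzeroIdeal J -> nonzeroIdeal (idealMul I J).
Proof.
move=> nI nJ; have [x Ix x0] := nonzeroIdeal_exists nI.
have [y Jy y0] := nonzeroIdeal_exists nJ.
case: nI nJ => [[Im IO] _] [[Jm JO] _]; split; first split.
- exact: submoduleM.
- by move=> z /(idealMul_subl Im JO)/IO.
apply/submodule_neq0P; first exact: idealMul0.
by exists (x * y); [exact: idealMul_mem|rewrite mulf_neq0].
Qed.

Lemma nonzeroIdeal1 : nonzeroIdeal OK.
Proof.
split; first by split=> //; exact: submodule_integer.
apply/submodule_neq0P; first exact: integer0.
by exists 1; [exact: integer1|exact: oner_neq0].
Qed.

Lemma nonzeroIdeal_principal x :
  OK x -> x != 0 -> nonzeroIdeal (principalIdeal x).
Proof.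
move=> Ox x0; split; first split.
- exact: submodule_principal.
- exact: principal_integral.
apply/submodule_neq0P; last by exists x => //; exact: principal_mem.
by case: (submodule_principal x).
Qed.

Lemma nonzeroIdeal_class I : nonzeroIdeal I -> classGroup K (idealClass I).
Proof.
case=> [[Im IO] I0]; exists I => //; split=> //.
exists 1; split; [exact: integer1|exact: oner_neq0|].
by move=> a /IO; rewrite mul1r.
Qed.

(** [I] belongs to its own coset because 1 generates [OK]; reading this membership in the coset of
    [J] yields x. *)
Lemma class_eq I J : integerSubmodule I -> idealClass I = idealClass J ->
  exists2 x, x != 0 & I = idealMul (principalIdeal x) J.
Proof.
move=> Im IJ.
have: idealClass I I.
  exists OK; last exact: idealMul1.
  by exists 1; [exact: oner_neq0|exact: principal1].
by rewrite IJ => -[_ [x x0 <-] <-]; exists x; rewrite // idealMulC.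
Qed.

Lemma class_scale x I : x != 0 ->
  idealClass (idealMul (principalIdeal x) I) = idealClass I.
Proof.
move=> x0; apply/seteqP; split=> _ [_ [y y0 <-] <-].
  exists (principalIdeal (x * y)).
    by exists (x * y); rewrite //= mulf_neq0.
  by rewrite -principalM idealMulA [idealMul I _]idealMulC.
exists (principalIdeal (x^-1 * y)).
  by exists (x^-1 * y); rewrite //= mulf_neq0 ?invr_eq0.
rewrite [LHS]idealMulC idealMulA principalM mulrAC mulVf// mul1r.
by rewrite idealMulC.
Qed.

Lemma unitIntegerP x : OK x -> (principalIdeal x = OK) <-> unitInteger x.
Proof.
move=> Ox; split=> [xO|[_ [y Oy xy]]].
  split=> //; have [y Oy yx] : principalIdeal x 1.
    by rewrite xO; exact: integer1.
  by exists y; rewrite // mulrC.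
apply/seteqP; split; first exact: principal_integral.
move=> z Oz; exists (z * y); first exact: integerM.
by rewrite -mulrA [y * x]mulrC xy mulr1.
Qed.

End IdealArithmetic.

(** * Pigeonhole and congruent rows of integer matrices *)

Lemma fin_pigeonhole (S T : finType) (f : S -> T) :
  (#|T| < #|S|)%N -> exists i j, i != j /\ f i = f j.
Proof.
move=> ltTS; apply: contrapT => nex.
suff /leq_card : injective f by rewrite leqNgt ltTS.
move=> i j fij; apply/eqP; apply: contrapT => /negP ij; apply: nex.
by exists i, j.
Qed.

(* In the Smith form M = L D R only the first n columns of L matter, and
   D R = L^-1 M has rows in the row lattice of M; so two rows of L that agree
   modulo N on these columns give two rows of M congruent modulo N times that
   lattice. *)
Lemma rows_congruent (N n : nat) : exists B, forall M : 'M[int]_(B, n),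
  exists i j, i != j /\
    exists e : 'rV_B, row i M - row j M = N.+1%:Z *: (e *m M).
Proof.
(* The pigeonhole needs more than [N.+1 ^ n] rows; the extra [n] gives [n <= B], so that the first n
   columns of [L] exist. *)
exists (N.+1 ^ n + n).+1; set B := _.+1 => M.
have [L uL [R _ [d _ ME]]] := int_Smith_normal_form M.
set S := \matrix_(i, j) _ in ME.
have leB : (n <= B)%N by rewrite leqW // leq_addl.
pose f (i : 'I_B) : {ffun 'I_n -> 'I_N.+1} :=
  [ffun k => inord `|(L i (widen_ord leB k) %% N.+1%:Z)%Z|].
have [|i [j [ij /ffunP fij]]] := @fin_pigeonhole _ _ f.
  by rewrite card_ffun !card_ord ltnS leq_addr.
exists i, j; split=> //.
have Lij (k : 'I_B) : (k < n)%N ->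
    exists q, L i k - L j k = N.+1%:Z * q.
  move=> kn; have := fij (Ordinal kn); rewrite !ffunE.
  have -> : widen_ord leB (Ordinal kn) = k by exact: val_inj.
  move=> /(congr1 (@nat_of_ord _)); rewrite !inordK ?ltz_mod//; last 2 first.
  - by rewrite -ltz_nat gez0_abs ?modz_ge0// ltz_pmod.
  - by rewrite -ltz_nat gez0_abs ?modz_ge0// ltz_pmod.
  move=> /(congr1 Posz); rewrite !gez0_abs ?modz_ge0// => /eqP.
  rewrite eqz_mod_dvd => /dvdzP[q qE]; exists q; by rewrite qE mulrC.
(* [c] holds the quotients by [N.+1] of the differences of the two rows of [L]. Its entries from n
   on do not affect the product, since those rows of [S] vanish; 0 is a default there. *)
pose c : 'rV[int]_B := \row_k
  (if pselect (exists q, L i k - L j k = N.+1%:Z * q) is left e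
   then projT1 (cid e) else 0).
exists (c *m invmx L).
rewrite ME -!mulmxA mulKmx// !row_mul -mulmxBl scalemxAl !mulmxA.
congr (_ *m _); apply/rowP => l; rewrite !mxE; apply: eq_bigr => k _.
rewrite !mxE; have [kl|kl] := eqVneq (k : nat) l; last first.
  by rewrite !mulr0n !mulr0.
congr (_ * _); case: pselect => [e|]; first by case: cid.
by case; apply: Lij; rewrite kl.
Qed.

(** * Residues modulo a nonzero integer of K, finite generation of ideals, and Nakayama's lemma *)

Section Finiteness.
Variable K : fieldExtType rat.
Local Notation OK := (ringOfIntegers K).
Implicit Types (M I J L P : set K) (x y z d : K).

Lemma rat_common_denominator (T : finType) (c : T -> rat) :
  exists2 D : int, D != 0 & forall i, exists m : int, D%:~R * c i = m%:~R.
Proof.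
exists (\prod_i denq (c i)); first by apply/prodf_neq0 => i _; exact: denq_neq0.
move=> i; exists ((\prod_(j | j != i) denq (c j)) * numq (c i)).
rewrite (bigD1 i)//= !rmorphM /= -[X in _ * _ * X = _]divq_num_den.
rewrite mulrA mulrAC; congr (_ * _).
by rewrite mulrC mulKf// intr_eq0 denq_neq0.
Qed.

(** Coordinates in a rational basis of K, cleared by a common denominator [D], form an integer
    matrix with two congruent rows. The quotient y is an integer combination of the [f l]
    themselves, hence integral even if the basis is not. *)
Lemma residues_nat (N : nat) : exists B, forall f : 'I_B -> K,
  (forall i, OK (f i)) ->
  exists i j, i != j /\ exists2 y, OK y & f i - f j = N.+1%:R * y.
Proof.
have [B MB] := rows_congruent N (\dim {:K}); exists B => f Of.
pose b := vbasis {:K}.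
have [D D0 /choice[m mE]] := rat_common_denominator
  (fun ik : 'I_B * 'I_(\dim {:K}) => coord b ik.2 (f ik.1)).
pose M : 'M[int]_(B, \dim {:K}) := \matrix_(i, k) m (i, k).
have fE i : D%:~R * f i = \sum_k (M i k)%:~R * b`_k.
  rewrite {1}(coord_vbasis (memvf (f i))) mulr_sumr; apply: eq_bigr => k _.
  rewrite mxE -(rmorph_int (in_alg K)) -[in RHS](rmorph_int (in_alg K)) /=.
  by rewrite -mE -!scalerAl !mul1r scalerA.
have [i [j [ij [e eE]]]] := MB M; exists i, j; split=> //.
exists (\sum_l (e 0 l)%:~R * f l).
  by apply: integer_sum => l; apply: integerM => //; exact: integer_int.
have D0' : D%:~R != 0 :> K.
  by rewrite -(rmorph_int (in_alg K)) fmorph_eq0 intr_eq0.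
apply: (mulfI D0'); rewrite mulrBr !fE -sumrB [RHS]mulrCA mulr_sumr.
under [in RHS]eq_bigr do rewrite mulrCA fE mulr_sumr.
rewrite exchange_big /= mulr_sumr; apply: eq_bigr => k _.
rewrite -mulrBl -rmorphB /=; have /rowP/(_ k) := eE; rewrite !mxE => ->.
rewrite rmorphM rmorph_sum/= -mulrA; congr (_ * _).
by rewrite mulr_suml; apply: eq_bigr => l _; rewrite rmorphM /= mulrA.
Qed.

(** The multiple of d is, up to sign, the lowest nonzero coefficient of a monic integer polynomial
    vanishing at d. The induction strips factors X, so it keeps only that the polynomial is
    nonzero. *)
Lemma integer_dvd_nat d : OK d -> d != 0 ->
  exists N, exists2 y, OK y & N.+1%:R = d * y.
Proof.
move=> Od d0.
suff [n n0 [y Oy ny]] : exists2 n : int, n != 0 &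
    exists2 y, OK y & n%:~R = d * y.
  case: n n0 ny => [[|N]//|N] _ ny; first by exists N, y.
  exists N, (- y); last by rewrite mulrN -ny NegzE intrN opprK.
  by rewrite -[- y]add0r; apply: integerB => //; exact: integer0.
case: (Od) => p /monic_neq0 p0 pd; elim/poly_ind: p p0 pd => [|p n IHp] pn0 pd.
  by rewrite eqxx in pn0.
have pdE : (map_poly intr p).[d] * d = - n%:~R.
  apply/eqP; rewrite -subr_eq0 opprK; move: pd.
  by rewrite rmorphD rmorphM /= map_polyX map_polyC /root !hornerE.
have [n0|n0] := eqVneq n 0.
  apply: IHp; first by apply: contra pn0 => /eqP ->; rewrite n0 mul0r add0r.
  by apply/eqP/(mulIf d0); rewrite pdE n0 mul0r oppr0.
exists n => //; exists (- (map_poly intr p).[d]); last first.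
  by rewrite mulrN mulrC pdE opprK.
rewrite -[- _]add0r; apply: integerB; first exact: integer0.
apply: integral_horner => //; apply/(integral_poly (intr : int -> K)) => i.
rewrite coef_map; exact: integer_int.
Qed.

(** As d divides some [N.+1] in [OK], congruence modulo [N.+1] implies congruence modulo d. The
    order i < j is what makes the polynomial monic when f runs through powers. *)
Lemma residues d : OK d -> d != 0 ->
  exists B, forall f : nat -> K, (forall i, (i < B)%N -> OK (f i)) ->
  exists i j, (i < j < B)%N /\ exists2 y, OK y & f j - f i = d * y.
Proof.
move=> Od d0; have [N [y Oy Ny]] := integer_dvd_nat Od d0.
have [B HB] := residues_nat N; exists B => f Of.
have [|i [j [ij [z Oz fz]]]] := HB (fun i => f i).
  by move=> i; apply: Of.
wlog ltij : i j ij z Oz fz / (j < i)%N.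
  move=> W; case: (ltngtP i j) ij => [ltij|ltji|/val_inj ->] ij.
  - apply: (W j i _ (- z)) => //; first by rewrite eq_sym.
      by rewrite -[- z]add0r; apply: integerB => //; exact: integer0.
    by rewrite mulrN -fz opprB.
  - exact: (W i j ij z).
  - by rewrite eqxx in ij.
exists j, i; split; first by rewrite ltij ltn_ord.
by exists (y * z); [exact: integerM|rewrite fz Ny mulrA].
Qed.

(* M contains d x^n for every n, so pigeonhole modulo d puts some x^j - x^i
   in OK: x is integral over OK. *)
Lemma integer_stabilizer M x : nonzeroIdeal M ->
  (forall y, M y -> M (x * y)) -> OK x.
Proof.
move=> nM xM; have [d Md d0] := nonzeroIdeal_exists nM.
case: nM => [[_ MO] _].
have xnd n : M (x ^+ n * d).
  by elim: n => [|n IHn]; rewrite ?mul1r// exprS -mulrA; exact: xM.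
have Od := MO _ Md; have [B HB] := residues Od d0.
have [|i [j [/andP[ij _] [y Oy xy]]]] := HB (fun n => x ^+ n * d).
  by move=> n _; exact: MO.
have {}xy : x ^+ j - x ^+ i = y.
  by apply: (mulIf d0); rewrite mulrBl xy mulrC.
apply: (@integral_root_monic _ _ _ x ('X^j - ('X^i + y%:P))).
- rewrite monicE lead_coefDl ?lead_coefXn// size_polyN size_polyXn.
  rewrite (leq_ltn_trans (size_polyD _ _))// gtn_max size_polyXn !ltnS ij /=.
  exact: leq_trans (size_polyC_leq1 _) (leq_trans _ ij).
- by rewrite /root !hornerE -xy; apply/eqP; ring.
apply/(integral_poly (intr : int -> K)) => k; rewrite coefB coefD !coefXn coefC.
by apply: integerB; [|apply: integerD]; try case: eqP => // _;
  rewrite ?integer0; try exact: integer_int 0; try exact: integer_int 1.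
Qed.

(** Take a longest list of elements of M pairwise incongruent modulo d. [residues] bounds its
    length, and maximality makes every element of M congruent to a listed one. *)
Lemma ideal_representatives M d : integralIdeal M -> OK d -> d != 0 ->
  exists2 s : seq K, {in s, forall x, M x} &
    forall x, M x -> exists2 r, r \in s & exists2 y, OK y & x - r = d * y.
Proof.
move=> [Mm MO] Od d0; have [B HB] := residues Od d0.
pose e a b := ~~ `[< exists2 y, OK y & a - b = d * y >].
pose Q n := `[< exists s,
  [/\ size s = n, {in s, forall x, M x} & pairwise e s] >].
have Q0 : exists n, Q n by exists 0%N; apply/asboolP; exists [::].
have QB n : Q n -> (n <= B)%N.
  move=> /asboolP[s [sn sM /(pairwiseP 0) se]].
  rewrite leqNgt; apply/negP => ltBn.
  have [|i [j [/andP[ij jB] [y Oy yE]]]] := HB (fun i => nth 0 s i).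
    by move=> i iB; apply/MO/sM/mem_nth; rewrite sn (ltn_trans iB).
  have [jn iN] : (j < size s)%N /\ (i < size s)%N.
    by rewrite sn (ltn_trans jB)// (ltn_trans (ltn_trans ij jB)).
  move: (se i j iN jn ij) => /negP; apply; apply/asboolP.
  exists (- y); last by rewrite mulrN -yE opprB.
  by rewrite -[- y]add0r; apply: integerB => //; exact: integer0.
case: (ex_maxnP Q0 QB) => n /asboolP[s [sn sM se]] nmax.
exists s => // x Mx; apply: contrapT => nex.
have /nmax : Q n.+1; last by rewrite ltnn.
apply/asboolP; exists (x :: s); split=> /=; first by rewrite sn.
  by move=> y; rewrite inE => /predU1P[->|/sM].
rewrite se andbT; apply/allP => r rs; apply/negP => /asboolP xr; apply: nex.
by exists r.
Qed.

(** Recursion on the list of generators allows them to be eliminated one at a time in [nakayama]. *)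
Fixpoint combination J (s : seq K) x : Prop :=
  if s is a :: s' then exists c y, [/\ J c, combination J s' y & x = c * a + y]
  else x = 0.

Lemma combination0 J s : J 0 -> combination J s 0.
Proof.
by move=> J0; elim: s => //= a s IHs; exists 0, 0; rewrite mul0r addr0.
Qed.

Lemma combinationD J s x y : (forall a b, J a -> J b -> J (a + b)) ->
  combination J s x -> combination J s y -> combination J s (x + y).
Proof.
move=> JD; elim: s x y => /= [_ _ -> ->|a s IHs x y]; first by rewrite addr0.
move=> [c [u [Jc su ->]]] [c' [u' [Jc' su' ->]]]; exists (c + c'), (u + u').
by split; [exact: JD|exact: IHs|ring].
Qed.

Lemma combinationM J J' b s x : (forall c, J c -> J' (b * c)) ->
  combination J s x -> combination J' s (b * x).
Proof.
move=> JJ'; elim: s x => /= [_ ->|a s IHs x]; first by rewrite mulr0.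
move=> [c [u [Jc su ->]]]; exists (b * c), (b * u).
by split; [exact: JJ'|exact: IHs|ring].
Qed.

Lemma combination_mem J s a : J 0 -> J 1 -> a \in s -> combination J s a.
Proof.
move=> J0 J1; elim: s => //= b s IHs; rewrite inE => /predU1P[->|/IHs sa].
  by exists 1, 0; split; [|exact: combination0|ring].
by exists 0, a; split=> //; ring.
Qed.

(** A nonzero d in M together with representatives of M modulo d generates M. *)
Lemma finitely_generated M : nonzeroIdeal M ->
  exists2 s, {in s, forall x, M x} & forall x, M x -> combination OK s x.
Proof.
move=> nM; have [d Md d0] := nonzeroIdeal_exists nM; case: nM => MI _.
have Od := MI.2 _ Md; have [s sM sP] := ideal_representatives MI Od d0.
exists (d :: s) => [x|x Mx]; first by rewrite inE => /predU1P[->|/sM].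
have [r rs [y Oy xr]] := sP _ Mx; exists y, r; split=> //.
  by apply: combination_mem => //; [exact: integer0|exact: integer1].
by rewrite mulrC -xr subrK.
Qed.

(** Eliminating the generators of M one by one produces v congruent to 1 modulo J with v M = 0.
    Since M is nonzero in a field, v = 0, so J contains 1. *)
Lemma nakayama M J : nonzeroIdeal M -> integralIdeal J ->
  M `<=` idealMul J M -> J 1.
Proof.
move=> nM [Jm JO] MJM; have [s sM sP] := finitely_generated nM.
have [x Mx x0] := nonzeroIdeal_exists nM; case: nM => [[Mm MO] _].
case: (Jm) => J0 JD JM.
have elim_gens s' u : {in s', forall a, M a} -> J (1 - u) -> OK u ->
    (forall y, M y -> combination J s' (u * y)) ->
  exists2 v, J (1 - v) & forall y, M y -> v * y = 0.
  elim: s' u => [|a s' IHs] u s'M Ju Ou us; first by exists u.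
  have [c [y [Jc s'y ay]]] := us a (s'M _ (mem_head _ _)).
  (* From u a = c a + y, the product (u - c) a = y involves only the remaining generators, so
     multiplying by u - c removes a from every u z. *)
  apply: (IHs ((u - c) * u)).
  - by move=> b bs; apply: s'M; rewrite inE bs orbT.
  - have -> : 1 - (u - c) * u = (1 - u) + u * (1 - u) + u * c by ring.
    exact: JD (JD _ _ Ju (JM _ _ Ou Ju)) (JM _ _ Ou Jc).
  - by apply: integerM => //; apply: integerB => //; exact: JO.
  move=> z Mz; have [c' [y' [Jc' s'y' zy]]] := us z Mz.
  have -> : (u - c) * u * z = c' * y + (u - c) * y'.
    rewrite -mulrA zy mulrDr mulrCA mulrBl ay; ring.
  apply: combinationD => //.
    by apply: combinationM s'y => b; apply: JM; exact: JO.
  by apply: combinationM s'y' => b; apply: JM; apply: integerB => //; exact: JO.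
have [||y My|v Jv v0] := elim_gens s 1 sM.
- by rewrite subrr.
- exact: integer1.
- rewrite mul1r; move: y {My} (MJM _ My); apply: idealMul_sub.
  + exact: combination0.
  + by move=> ? ?; exact: combinationD.
  move=> b y Jb My; apply: combinationM (sP _ My) => c Oc.
  by rewrite mulrC; exact: JM.
have /eqP := v0 _ Mx; rewrite mulf_eq0 (negPf x0) orbF => /eqP vE.
by rewrite vE subr0 in Jv.
Qed.
End Finiteness.

(** * Consequences of a finite class group: invertibility, cancellation and division of ideals *)

Section ClassGroup.
Variables (K : fieldExtType rat) (h : nat).
Hypothesis card_Cl : (classGroup K #= `I_h)%card.
Local Notation OK := (ringOfIntegers K).
Implicit Types (I J A B P : set K) (x y z : K).

Lemma class_pigeonhole (S : finType) (F : S -> set K) :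
    (forall i, nonzeroIdeal (F i)) -> (h < #|S|)%N ->
  exists i j, i != j /\
    exists2 x, x != 0 & F i = idealMul (principalIdeal x) (F j).
Proof.
move=> nF hS; have /card_set_bijP[c [cI cinj _]] := card_Cl.
have ch i : (c (idealClass (F i)) < h)%N.
  by apply: cI; exact: nonzeroIdeal_class.
have [|i [j [ij cij]]] := @fin_pigeonhole S 'I_h (fun i => Ordinal (ch i)).
  by rewrite card_ord.
exists i, j; split=> //; apply: class_eq; first by case: (nF i) => -[].
by apply: cinj; rewrite ?inE; [exact: nonzeroIdeal_class..|case: cij].
Qed.

Lemma unit_idealP J : integralIdeal J -> J 1 -> J = OK.
Proof.
move=> [[_ _ JM] JO] J1; apply/seteqP; split=> // x Ox.
by rewrite -[x]mulr1; exact: JM.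
Qed.

(* Hurwitz's argument: two powers of I lie in the same class, I^a = x I^b with
   a < b, so M = I^a satisfies M = J M for J = x I^(b-a); then J is integral,
   and it contains 1 by Nakayama. *)
Lemma ideal_invertible I : nonzeroIdeal I ->
  exists J z, [/\ nonzeroIdeal J, z != 0 & idealMul I J = principalIdeal z].
Proof.
move=> nI; pose F n := iter n (idealMul I) OK.
have nF n : nonzeroIdeal (F n).
  by elim: n => [|n IHn]; [exact: nonzeroIdeal1|exact: nonzeroIdealM].
have FD a b : F (a + b)%N = idealMul (F a) (F b).
  elim: a => [|a IHa]; last by rewrite addSn /= IHa idealMulA.
  by rewrite /= idealMulC idealMul1//; case: (nF b) => -[].
have [|a [b [ab [x x0 Fab]]]] := @class_pigeonhole 'I_h.+1 _ (fun i => nF i).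
  by rewrite card_ord.
wlog ltab : a b ab x x0 Fab / (a < b)%N.
  move=> W; case: (ltngtP a b) ab => [ltab|ltba|/val_inj ->] ab.
  - exact: (W a b ab x).
  - apply: (W b a _ x^-1) => //; [by rewrite eq_sym|by rewrite invr_eq0|].
    rewrite Fab idealMulA principalM mulVf// principal1 idealMulC idealMul1//.
    by case: (nF b) => -[].
  - by rewrite eqxx in ab.
set k := (b - a).-1; have bE : (b : nat) = (a + k.+1)%N.
  by rewrite /k prednK ?subn_gt0// subnKC// ltnW.
pose J := idealMul (principalIdeal x) (F k.+1).
have JM : F a = idealMul J (F a).
  by rewrite {1}Fab bE FD /J -idealMulA; congr idealMul; rewrite idealMulC.
have JI : integralIdeal J.
  split; first exact/submoduleM/submodule_principal.
  move=> y Jy; apply: (integer_stabilizer (nF a)) => u Fu.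
  by rewrite JM; exact: idealMul_mem.
have /unit_idealP-/(_ JI) JE : J 1.
  by apply: (nakayama (nF a) JI); rewrite -JM.
(* Since x I^(k+1) = OK, the product of I and I^k is generated by x^-1. *)
exists (F k), x^-1; split=> //; first by rewrite invr_eq0.
rewrite -[RHS]idealMul1; last exact: submodule_principal.
rewrite -JE /J idealMulA principalM mulVf// principal1 [RHS]idealMulC.
by rewrite idealMul1//; case: (nF k.+1) => -[].
Qed.

Lemma ideal_cancel I A B : nonzeroIdeal I ->
    integerSubmodule A -> integerSubmodule B ->
  idealMul I A = idealMul I B -> A = B.
Proof.
move=> nI Am Bm; have [J [z [_ z0 IJ]]] := ideal_invertible nI.
move=> /(congr1 (idealMul J)).
by rewrite !idealMulA [idealMul J I]idealMulC IJ; exact: principal_cancel.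
Qed.

(** To contain is to divide: with I J = (z), the quotient is z^-1 A J, which is integral because A J
    lies in I J = (z). *)
Lemma ideal_divide I A : nonzeroIdeal I -> nonzeroIdeal A -> A `<=` I ->
  exists2 B, nonzeroIdeal B & A = idealMul I B.
Proof.
move=> nI nA AI; have [J [z [nJ z0 IJ]]] := ideal_invertible nI.
have Am : integerSubmodule A by case: nA => -[].
have AJm : integerSubmodule (idealMul A J) by exact: submoduleM.
exists (idealMul (principalIdeal z^-1) (idealMul A J)); last first.
  rewrite idealMulC -!idealMulA [idealMul J I]idealMulC IJ.
  rewrite [idealMul A _]idealMulC idealMulA principalM mulVf// principal1.
  by rewrite idealMulC idealMul1.
split; first split.
- exact/submoduleM/submodule_principal.
- rewrite mul_principal// => _ [y AJy <-].
  have : principalIdeal z y.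
    by rewrite -IJ idealMulC; move: AJy; rewrite idealMulC; exact: idealMulS.
  by case=> a Oa <-; rewrite mulrCA mulVf// mulr1.
apply/submodule_neq0P; first exact: idealMul0.
have [y AJy y0] := nonzeroIdeal_exists (nonzeroIdealM nA nJ).
exists (z^-1 * y); last by rewrite mulf_neq0// invr_eq0.
by apply: idealMul_mem => //; exact: principal_mem.
Qed.

Lemma primeIdealM P A B : primeIdeal P -> A `<=` OK -> B `<=` OK ->
  idealMul A B `<=` P -> A `<=` P \/ B `<=` P.
Proof.
move=> [_ _ PM] AO BO ABP; apply: contrapT => /not_orP[nA nB].
apply: nA => x Ax; apply: contrapT => nPx; apply: nB => y By.
by case: (PM x y (AO _ Ax) (BO _ By) (ABP _ (idealMul_mem Ax By))).
Qed.

(** * Unique factorization of products of primes and irreducible generators *)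

Section PrimeProducts.
Variables (T : eqType) (p : T -> set K).
Hypothesis p_prime : forall i, primeIdeal (p i).
Hypothesis p_neq0 : forall i, p i != [set 0].

Let prodp s := \big[@idealMul K/OK]_(i <- s) p i.

Lemma nonzero_prime i : nonzeroIdeal (p i).
Proof. by split=> //; case: (p_prime i). Qed.

Lemma nonzero_prodp s : nonzeroIdeal (prodp s).
Proof.
elim: s => [|i s IHs]; rewrite /prodp ?big_nil ?big_cons.
  exact: nonzeroIdeal1.
by apply: nonzeroIdealM => //; exact: nonzero_prime.
Qed.

Lemma submodule_prodp s : integerSubmodule (prodp s).
Proof. by case: (nonzero_prodp s) => -[]. Qed.

Lemma prodp_cat s1 s2 : prodp (s1 ++ s2) = idealMul (prodp s1) (prodp s2).
Proof.
elim: s1 => [|i s1 IHs]; last by rewrite /prodp /= !big_cons -idealMulA -IHs.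
by rewrite /= {2}/prodp big_nil idealMulC idealMul1//; exact: submodule_prodp.
Qed.

(** Induction on s: the first prime contains A B, hence A or B; it is divided out of that factor and
    cancelled on both sides. *)
Lemma prodp_factor s A B : nonzeroIdeal A -> nonzeroIdeal B ->
    idealMul A B = prodp s ->
  exists s1 s2, [/\ perm_eq s (s1 ++ s2), A = prodp s1 & B = prodp s2].
Proof.
have integral C : nonzeroIdeal C -> C `<=` OK by case=> -[].
have submod C : nonzeroIdeal C -> integerSubmodule C by case=> -[].
elim: s A B => [|i s IHs] A B nA nB.
  (* If A B = OK, both factors are [OK], since each contains the product. *)
  rewrite /prodp big_nil => AB; exists [::], [::]; rewrite big_nil.
  split=> //; apply/seteqP; split; try exact: integral.
    by rewrite -AB; apply: idealMul_subl; [exact: submod|exact: integral].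
  rewrite -AB idealMulC.
  by apply: idealMul_subl; [exact: submod|exact: integral].
rewrite /prodp big_cons -/(prodp s) => AB.
have split_left C D : nonzeroIdeal C -> nonzeroIdeal D ->
    idealMul C D = idealMul (p i) (prodp s) -> C `<=` p i ->
  exists s1 s2, [/\ perm_eq s (s1 ++ s2), C = prodp (i :: s1) & D = prodp s2].
  move=> nC nD CD Ci; have ni := nonzero_prime i.
  have [C' nC' CE] := ideal_divide ni nC Ci.
  have /(IHs _ _ nC' nD)[s1 [s2 [ss C'E DE]]] : idealMul C' D = prodp s.
    apply: (ideal_cancel ni); [exact/submoduleM/submod|exact: submodule_prodp|].
    by rewrite idealMulA -CE.
  by exists s1, s2; split=> //; rewrite /prodp big_cons -/(prodp s1) -C'E.
have [|Ai|Bi] := primeIdealM (p_prime i) (integral _ nA) (integral _ nB).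
- rewrite AB; apply: idealMul_subl; [exact/submod/nonzero_prime|].
  exact/integral/nonzero_prodp.
- have [s1 [s2 [ss AE BE]]] := split_left A B nA nB AB Ai.
  by exists (i :: s1), s2; rewrite /= perm_cons.
- rewrite idealMulC in AB.
  have [s1 [s2 [ss BE AE]]] := split_left B A nB nA AB Bi.
  exists s2, (i :: s1); split=> //.
  by rewrite perm_sym perm_catC /= perm_cons perm_sym.
Qed.

(** The minimal length is sought among all duplicate-free lists of indices with principal product,
    not only sublists of s; s supplies existence and the bound. *)
Lemma irreducible_subproduct s x : uniq s -> s != [::] -> x != 0 ->
    prodp s = principalIdeal x ->
  exists s' y, [/\ uniq s', s' != [::], (size s' <= size s)%N
    & irreducibleInteger y /\ prodp s' = principalIdeal y].
Proof.
move=> us s0 x0 sx.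
pose Q n := `[< exists s y,
  [/\ uniq s, s != [::], size s = n, y != 0 & prodp s = principalIdeal y] >].
have Qs : Q (size s) by apply/asboolP; exists s, x.
case: (ex_minnP (ex_intro Q _ Qs)) => n /asboolP[s' [y [+ + <-]]].
move=> us' s'0 y0 s'y nmin.
exists s', y; split=> //; first exact: nmin.
have Oy : OK y.
  case: (nonzero_prodp s') => -[_ +] _; apply.
  by rewrite s'y; exact: principal_mem.
split=> //; split=> //.
  (* If y were a unit, the product would be [OK], and the first prime of the nonempty list would
     contain 1. *)
  move=> /(unitIntegerP Oy) yO; case: s' s'0 s'y {us' nmin} => // i s' _.
  rewrite yO /prodp big_cons => ps'; case: (p_prime i) => -[im _] + _; apply.
  apply: (@idealMul_subl _ _ (prodp s') im).
    by case: (nonzero_prodp s') => -[].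
  by rewrite ps'; exact: integer1.
move=> a b Oa Ob yab; move: y0; rewrite yab mulf_eq0 negb_or => /andP[a0 b0].
have [|s1 [s2 [ss aE bE]]] := @prodp_factor s' _ _
    (nonzeroIdeal_principal Oa a0) (nonzeroIdeal_principal Ob b0).
  by rewrite principalM -yab.
have [s10|s10] := eqVneq s1 [::].
  by left; apply/(unitIntegerP Oa); rewrite aE s10 /prodp big_nil.
right; apply/(unitIntegerP Ob); rewrite bE.
(* The nonempty [s1] has product (a), so by minimality it has full length; then [s2] is empty and b
   is a unit. *)
have /nmin : Q (size s1).
  apply/asboolP; exists s1, a; split=> //.
  by move: us'; rewrite (perm_uniq ss) cat_uniq => /andP[].
rewrite (perm_size ss) size_cat -[leqRHS]addn0 leq_add2l leqn0 => /nilP ->.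
by rewrite /prodp big_nil.
Qed.

End PrimeProducts.

(** * A short principal product by pigeonhole in the class group *)

Lemma short_principal_product (m t : nat) (p : 'I_m -> set K)
    (p_prime : forall i, primeIdeal (p i)) (p_neq0 : forall i, p i != [set 0])
    (r : 'I_t -> 'I_m) (r_inj : injective (fun j => idealClass (p (r j)))) :
    (h <= m)%N ->
  exists s x, [/\ uniq s, s != [::], (size s <= h - t + 1)%N, x != 0
    & \big[@idealMul K/OK]_(i <- s) p i = principalIdeal x].
Proof.
move=> le_h_m; set prodp := fun s => \big[@idealMul K/OK]_(i <- s) p i.
have np := nonzero_prime p_prime p_neq0.
have nprod s : nonzeroIdeal (prodp s) by exact: nonzero_prodp.
have mprod s : integerSubmodule (prodp s) by case: (nprod s) => -[].
have inj_r : injective r by move=> i j rij; apply: r_inj; rewrite /= rij.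
(* The integral ideal [J j] represents the inverse of the class of [p (r j)]. *)
have /choice[J /choice[z Jz]] j := ideal_invertible (np (r j)).
pose L := enum [predC codom r].
have sL : (h - t <= size L)%N.
  have <- : (m - t = size L)%N.
    apply/eqP; rewrite -(eqn_add2l #|codom r|) /L -cardE cardC.
    rewrite card_codom// !card_ord subnKC// -[t]card_ord -[leqRHS]card_ord.
    exact: leq_card inj_r.
  exact: leq_sub2r.
have uL : uniq L by exact: enum_uniq.
(* The prefixes of [L] of lengths 0 to [h - t], the empty one included, bring the number of ideals
   above h. *)
pose F (u : 'I_t + 'I_(h - t).+1) :=
  match u with inl j => J j | inr k => prodp (take k L) end.
have nF u : nonzeroIdeal (F u) by case: u => [j|k] //=; case: (Jz j).
(* An inverse equivalent to a prefix: adjoining [r j], which is not in [L], makes the product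
   principal, and the length is at most [h - t + 1]. *)
have mixed j (k : 'I_(h - t).+1) x : x != 0 ->
    J j = idealMul (principalIdeal x) (prodp (take k L)) ->
  exists s y, [/\ uniq s, s != [::], (size s <= h - t + 1)%N, y != 0
    & prodp s = principalIdeal y].
  move=> x0 JE; have [_ z0 IJ] := Jz j.
  exists (r j :: take k L), (x^-1 * z j); split=> //=.
  - rewrite take_uniq// andbT; apply/negP => /mem_take.
    by rewrite mem_enum inE codom_f.
  - by rewrite addn1 ltnS size_take_min (leq_trans (geq_minl _ _))// -ltnS.
  - by rewrite mulf_neq0// invr_eq0.
  rewrite -principalM -IJ JE /prodp big_cons -/(prodp (take k L)).
  rewrite [idealMul (p _) (idealMul (principalIdeal x) _)]idealMulCA idealMulA.
  rewrite principalM mulVf// principal1 [RHS]idealMulC idealMul1//.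
  by apply: submoduleM; case: (np (r j)) => -[].
have inv_eq (I1 I2 : set K) x : x != 0 -> integerSubmodule I2 ->
    I1 = idealMul (principalIdeal x) I2 ->
    I2 = idealMul (principalIdeal x^-1) I1.
  move=> x0 I2m ->; rewrite idealMulA principalM mulVf// principal1.
  by rewrite idealMulC idealMul1.
have [|u [v [uv [x x0 Fuv]]]] := class_pigeonhole nF.
  by rewrite card_sum !card_ord addnS ltnS -leq_subLR.
(* Two equivalent prefixes: cancelling the shorter one leaves the segment between them, which is
   nonempty and principal. *)
have partial (k k' : 'I_(h - t).+1) y : (k < k')%N -> y != 0 ->
    prodp (take k L) = idealMul (principalIdeal y) (prodp (take k' L)) ->
  exists s y, [/\ uniq s, s != [::], (size s <= h - t + 1)%N, y != 0
    & prodp s = principalIdeal y].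
  move=> kk' y0 kE; have k'L : (k' <= size L)%N.
    by rewrite (leq_trans _ sL)// -ltnS.
  have sz : size (drop k (take k' L)) = (k' - k)%N.
    by rewrite size_drop size_takel.
  exists (drop k (take k' L)), y^-1; split=> //.
  - by rewrite drop_uniq// take_uniq.
  - by rewrite -size_eq0 sz subn_eq0 -ltnNge.
  - by rewrite sz addn1 (leq_trans (leq_subr _ _))// ltnW.
  - by rewrite invr_eq0.
  have takeE : prodp (take k' L) =
      idealMul (prodp (take k L)) (prodp (drop k (take k' L))).
    rewrite -(prodp_cat p_prime p_neq0) -{1}(cat_take_drop k (take k' L)).
    by rewrite take_takel// ltnW.
  apply: (ideal_cancel (nprod (take k L))).
  - exact: mprod.
  - exact: submodule_principal.
  by rewrite -takeE [RHS]idealMulC; apply: inv_eq kE.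
case: u v uv Fuv => [j|k] [j'|k'] /= uv Fuv.
(* Two equivalent inverses would put [p (r j)] and [p (r j')] in the same class, against the choice
   of [r]. *)
- have [_ zj0 IJ] := Jz j; have [_ zj'0 IJ'] := Jz j'.
  suff jj' : j = j' by rewrite jj' eqxx in uv.
  have pm : integerSubmodule (p (r j)) by case: (np (r j)) => -[].
  have pm' : integerSubmodule (p (r j')) by case: (np (r j')) => -[].
  have pE : idealMul (principalIdeal (z j)) (p (r j')) =
            idealMul (principalIdeal (x * z j')) (p (r j)).
    rewrite -IJ Fuv -principalM -IJ' -!idealMulA.
    rewrite idealMulCA; congr (idealMul _ _).
    by rewrite idealMulCA [RHS]idealMulCA [idealMul (p (r j)) _]idealMulC.
  apply: r_inj => /=; rewrite -(class_scale (p (r j)) (mulf_neq0 x0 zj'0)) -pE.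
  by rewrite class_scale.
- exact: mixed Fuv.
- apply: (mixed j' k x^-1); rewrite ?invr_eq0//; apply: inv_eq Fuv => //.
  by case: (Jz j') => -[[]].
- case: (ltngtP k k') uv => [kk'|k'k|/val_inj ->] uv.
  + exact: partial kk' x0 Fuv.
  + by apply: (partial k' k x^-1) => //; rewrite ?invr_eq0//; apply: inv_eq Fuv.
  + by rewrite eqxx in uv.
Qed.

End ClassGroup.

(** * Passage from duplicate-free lists of indices to index sets *)

Theorem proposition5p1 (K : fieldExtType rat) (h m t : nat)
    (card_Cl : (classGroup K #= `I_h)%card)
    (p : 'I_m -> set K)
    (p_prime : forall i : 'I_m, primeIdeal (p i))
    (p_neq0 : forall i : 'I_m, p i != [set 0])
    (le_h_m : (h <= m)%N)
    (card_classes : ([set idealClass (p i) | i in [set: 'I_m]] #= `I_t)%card) :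
  exists I : {set 'I_m},
    [/\ I != finset.set0,
        (#|I| <= h - t + 1)%N
      & exists pi : K,
          irreducibleInteger pi /\ idealProd p I = principalIdeal pi].
Proof.
(* One index is chosen for each of the t occupied classes. *)
have [r r_inj] : exists r : 'I_t -> 'I_m,
    injective (fun j => idealClass (p (r j))).
  have /card_set_bijP[c [_ _ csurj]] := card_classes.
  have /choice[r rE] (j : 'I_t) : exists i, c (idealClass (p i)) = j.
    by have [_ [i _ <-] ci] := csurj j (ltn_ord j); exists i.
  by exists r => i j /(congr1 c); rewrite /= !rE => /val_inj.
have [s [x [us s0 ss x0 sx]]] :=
  short_principal_product card_Cl p_prime p_neq0 r_inj le_h_m.
have [s' [y [us' s'0 ss' [yirr s'y]]]] :=
  irreducible_subproduct card_Cl p_prime p_neq0 us s0 x0 sx.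
pose I := finset.finset (fun i => i \in s').
have Is' : perm_eq (enum I) s'.
  apply: uniq_perm => //; first exact: enum_uniq.
  by move=> i; rewrite mem_enum finset.inE.
exists I; split.
- apply: contra s'0 => /eqP I0; rewrite -size_eq0 -(perm_size Is') -cardE I0.
  by rewrite finset.cards0.
- by rewrite cardE (perm_size Is') (leq_trans ss').
exists y; split=> //.
by rewrite -s'y /idealProd -big_enum; exact: perm_big.
Qed.
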